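(* Let $\mu,\nu\in\mathcal M_+(\mathcal X)$ have finite, nonzero total masses, let $r\ge1$, $\lambda>0$ and $\eta_1,\eta_2\ge0$. When restricted to measures of the form $c\cdot\mu\otimes\nu$ with $c\ge0$, the measure $$\pi^*:=c^*_{r;\eta;\lambda}\cdot\mu\otimes\nu$$ with constant $$c^*_{r;\eta;\lambda}:=e^{-\frac{\langle\mu\otimes\nu|d^r\rangle}{\mu(\mathcal X)\,\nu(\mathcal X)\,(\eta_1+\eta_2+1/\lambda)}}\;\mu(\mathcal X)^{-\frac{\eta_2}{\eta_1+\eta_2+1/\lambda}}\;\nu(\mathcal X)^{-\frac{\eta_1}{\eta_1+\eta_2+1/\lambda}}$$ is optimal for the entropy (Kullback–Leibler) regularized unbalanced optimal transport problem with Kullback–Leibler divergences; i.e., $c=c^*_{r;\eta;\lambda}$ minimizes $J_\lambda(c\cdot\mu\otimes\nu)$ among all $c\ge0$, where $J_\lambda$ is the objective of that problem.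
   Context: $\mathcal X\subset\mathbb R^m$; $\mathcal M_+(\mathcal X)$ is the set of non-negative Radon measures on $\mathcal X$; $d:\mathcal X\times\mathcal X\to[0,\infty)$ is a cost or distance function. $\tau_1,\tau_2$ are the coordinate projections on $\mathcal X\times\mathcal X$, and $\tau_{i\#}\pi=\pi\circ\tau_i^{-1}$. Write $\langle\pi|d^r\rangle:=\iint d(x,y)^r\,\pi(\mathrm dx,\mathrm dy)$. For non-negative measures $\alpha,\beta$ on a space $\mathcal Y$ (here $\mathcal Y=\mathcal X$ or $\mathcal X\times\mathcal X$), the generalized Kullback–Leibler divergence is $$D_{\mathrm{KL}}(\alpha\|\beta)=\int_{\mathcal Y}\log\Big(\frac{\mathrm d\alpha}{\mathrm d\beta}\Big)\,\mathrm d\alpha+\beta(\mathcal Y)-\alpha(\mathcal Y)$$ if $\alpha\ll\beta$ (and $+\infty$ otherwise; $0\log0=0$). The entropy regularized unbalanced optimal transport problem with Kullback–Leibler divergences is $$\mathrm{UOT}_{r;\eta;\lambda}(\mu,\nu)=\inf_{\pi\in\mathcal M_+(\mathcal X\times\mathcal X)}J_\lambda(\pi),$$ $$J_\lambda(\pi)=\langle\pi|d^r\rangle+\frac1\lambda D_{\mathrm{KL}}(\pi\|\mu\otimes\nu)+\eta_1D_{\mathrm{KL}}(\tau_{1\#}\pi\|\mu)+\eta_2D_{\mathrm{KL}}(\tau_{2\#}\pi\|\nu).$$ Conventions: $e^{-\infty}=0$ and $0\cdot\infty=0$. *)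

(* Defs.v *)
From HB Require Import structures.
From mathcomp Require Import all_boot all_order all_algebra.
From mathcomp Require Import all_classical all_reals all_analysis.

Set Implicit Arguments.
Unset Strict Implicit.
Unset Printing Implicit Defensive.

Import Order.TTheory GRing.Theory Num.Theory.
Import numFieldNormedType.Exports.

Local Open Scope classical_set_scope.
Local Open Scope ring_scope.
Local Open Scope ereal_scope.
Local Open Scope charge_scope.

(* A subset X of R^m as a topological (subspace topology) and measurable
   (Borel sigma-algebra) space in its own right.  Measurable types have to be
   pointed, hence the nonemptiness proof; the choice of the point plays no
   role. *)
Definition borel_subset (R : realType) (m : nat) (X : set 'rV[R]_m)
  (X0 : X !=set0) : Type := set_type X.

Section borel_subset_instances.
Context (R : realType) (m : nat) (X : set 'rV[R]_m) (X0 : X !=set0).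

HB.instance Definition _ := Topological.copy (borel_subset X0) (set_type X).

Let borel_subset_point : borel_subset X0 :=
  let x := cid X0 in exist _ (projT1 x) (mem_set (projT2 x)).

HB.instance Definition _ := isPointed.Build (borel_subset X0)
  borel_subset_point.

HB.instance Definition _ := @isMeasurable.Build
  (sigma_display (@open (borel_subset X0))) (borel_subset X0)
  <<s @open (borel_subset X0) >>
  (@sigma_algebra0 _ setT _) (@sigma_algebraC _ _)
  (@sigma_algebra_bigcup _ setT _).

End borel_subset_instances.

(* Radon: locally finite and inner regular with respect to compact sets.
   Compact subsets of X are closed, hence Borel. *)
Definition radon (R : realType) (m : nat) (X : set 'rV[R]_m) (X0 : X !=set0)
    (mu : {measure set (borel_subset X0) -> \bar R}) : Prop :=
  (forall x : borel_subset X0, exists U, [/\ open U, U x & mu U < +oo]) /\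
  (forall A, measurable A ->
     mu A = ereal_sup [set mu K | K in [set K | compact K /\ K `<=` A]]).

Section finite_product.
Context d1 d2 (T1 : measurableType d1) (T2 : measurableType d2)
  (R : realType).
Variables (mu : {finite_measure set T1 -> \bar R})
  (nu : {finite_measure set T2 -> \bar R}).

(* The canonical finite measure structure of _ \x _ is taken by products of
   probabilities; this name carries the one for products of finite measures. *)
Definition finite_product : set (T1 * T2)%type -> \bar R := mu \x nu.

HB.instance Definition _ := Measure.copy finite_product (mu \x nu).

Let finite_product_fin : fin_num_fun finite_product.
Proof.
apply: lty_fin_num_fun; rewrite /= /finite_product -setXTT product_measure1E//.
by rewrite lte_mul_pinfty// ?fin_num_measure// ltey_eq fin_num_measure.
Qed.

HB.instance Definition _ :=
  Measure_isFinite.Build _ _ _ finite_product finite_product_fin.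

End finite_product.

Section marginals.
Context d1 d2 (T1 : measurableType d1) (T2 : measurableType d2)
  (R : realType).
Variable pi : {finite_measure set (T1 * T2)%type -> \bar R}.

(* Named so that canonical structure inference finds their finite measure
   structure, whose construction needs measurability of the projections. *)
Definition marginal1 : set T1 -> \bar R := pushforward pi fst.
Definition marginal2 : set T2 -> \bar R := pushforward pi snd.

Let marginal1_measure : {measure set T1 -> \bar R} :=
  measure_function_pushforward__canonical__measure_function_Measure pi
    measurable_fst.
Let marginal2_measure : {measure set T2 -> \bar R} :=
  measure_function_pushforward__canonical__measure_function_Measure pi
    measurable_snd.

HB.instance Definition _ := isMeasure.Build _ _ _ marginal1
  (measure0 marginal1_measure) (measure_ge0 marginal1_measure)
  (@measure_semi_sigma_additive _ _ _ marginal1_measure).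
HB.instance Definition _ := isMeasure.Build _ _ _ marginal2
  (measure0 marginal2_measure) (measure_ge0 marginal2_measure)
  (@measure_semi_sigma_additive _ _ _ marginal2_measure).

Let marginal1_finite : fin_num_fun marginal1.
Proof.
by apply: lty_fin_num_fun; rewrite /= /marginal1 /pushforward preimage_setT
  ltey_eq fin_num_measure.
Qed.

Let marginal2_finite : fin_num_fun marginal2.
Proof.
by apply: lty_fin_num_fun; rewrite /= /marginal2 /pushforward preimage_setT
  ltey_eq fin_num_measure.
Qed.

HB.instance Definition _ :=
  Measure_isFinite.Build _ _ _ marginal1 marginal1_finite.
HB.instance Definition _ :=
  Measure_isFinite.Build _ _ _ marginal2 marginal2_finite.

End marginals.

(* Generalized Kullback-Leibler divergence.  Both measures are finite: otherwise
   the formula contains +oo - oo.  The convention 0 log 0 = 0 is automatic: the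
   points where the density vanishes form an alpha-null set. *)
Definition KL d (Y : measurableType d) (R : realType)
    (alpha beta : {finite_measure set Y -> \bar R}) : \bar R :=
  if `[< alpha `<< beta >] then
    (\int[alpha]_y lne ('d (charge_of_finite_measure alpha) '/d beta y))
      + beta setT - alpha setT
  else +oo.

Section UOT.
Context d (X : measurableType d) (R : realType).
Variables (dist : X -> X -> R) (r : R).

Definition transport_cost (pi : {measure set (X * X)%type -> \bar R}) :
    \bar R :=
  \int[pi]_z ((dist z.1 z.2) `^ r)%:E.

Variables (eta1 eta2 lambda : R).
Variables (mu nu : {finite_measure set X -> \bar R}).

Definition UOT_objective (pi : {finite_measure set (X * X)%type -> \bar R}) :
    \bar R :=
  transport_cost pi + (1 / lambda)%:E * KL pi (finite_product mu nu)
    + eta1%:E * KL (marginal1 pi) mu + eta2%:E * KL (marginal2 pi) nu.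

(* The exponential is taken in the extended reals, where exp(-oo) = 0, since
   the transport cost of the product measure may be infinite. *)
Definition cstar_val : R :=
  let s := (eta1 + eta2 + 1 / lambda)%R in
  (fine (expeR (- (transport_cost (finite_product mu nu)
                     / (mu setT * nu setT * s%:E))))
   * fine (mu setT) `^ (- (eta2 / s)) * fine (nu setT) `^ (- (eta1 / s)))%R.

Lemma cstar_val_ge0 : (0 <= cstar_val)%R.
Proof.
by rewrite /cstar_val !mulr_ge0 ?powR_ge0// fine_ge0// expeR_ge0.
Qed.

Definition cstar : {nonneg R} := NngNum cstar_val_ge0.

End UOT.

(* Main.v *)
(* For a measure proportional to its reference the Radon-Nikodym density is
   constant, so J(c) := J_lambda(c . mu (x) nu) is an explicit function of c.
   With M = mu(X), N = nu(X), s = eta1 + eta2 + 1/lambda and c* > 0 it reads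
     J(c) = M N s (c ln c - c ln c* - c) + K,
   K independent of c, and the tangent inequality for x ln x at c* concludes.
   If the transport cost of the product measure is infinite then c* = 0 and J
   is infinite on c > 0. *)
Require Import Defs.
From HB Require Import structures.
From mathcomp Require Import all_boot all_order all_algebra.
From mathcomp Require Import all_classical all_reals all_analysis.
From mathcomp Require Import measurable_realfun ring lra.

Set Implicit Arguments.
Unset Strict Implicit.
Unset Printing Implicit Defensive.

Import Order.TTheory GRing.Theory Num.Theory.
Import numFieldNormedType.Exports.

Local Open Scope classical_set_scope.
Local Open Scope ring_scope.

Lemma measurable_lne (R : realType) : measurable_fun setT (@lne R).
Proof.
(* The nested conditionals test membership in measurable sets, and the last branch is the real
   [ln]. *)
have -> : @lne R = fun x => (if x <= 0 then -oo else
    if x == +oo then +oo else (ln (fine x))%:E)%E.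
  by apply/funext => -[x | |] //=; rewrite leNye.
apply: (measurable_fun_ifT (f := fun x : \bar R => (x <= 0)%E)) => //.
  apply: (measurable_fun_bool true); rewrite setTI.
  rewrite (_ : _ @^-1` _ = [set` `]-oo, 0%E]]); first exact: emeasurable_itv.
  by apply/seteqP; split => x; rewrite /= in_itv.
apply: (measurable_fun_ifT (f := fun x : \bar R => x == +oo%E)) => //.
  apply: (measurable_fun_bool true); rewrite setTI.
  rewrite (_ : _ @^-1` _ = [set +oo%E]) ?emeasurable_set1//.
  by apply/seteqP; split => [x /= /eqP//|x ->/=]; rewrite eqxx.
by apply/measurable_EFinP; apply: measurableT_comp; [exact: measurable_ln|].
Qed.

Section KL_proportional.
Local Open Scope charge_scope.
Context d (Y : measurableType d) (R : realType).
Variables (alpha beta : {finite_measure set Y -> \bar R}) (c : R).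
Hypothesis c_ge0 : 0 <= c.
Hypothesis alphaE : forall A, measurable A -> alpha A = (c%:E * beta A)%E.

Let alpha_dom : alpha `<< beta.
Proof.
by apply/null_content_dominatesP => A mA A0; rewrite alphaE// A0 mule0.
Qed.

(** Over every measurable [A], both sides integrate against [beta] to [alpha A]. *)
Let density_cst :
  ae_eq beta setT ('d (charge_of_finite_measure alpha) '/d beta) (cst c%:E).
Proof.
apply: integral_ae_eq => //; first exact: Radon_Nikodym_integrable.
move=> A _ mA; rewrite -Radon_Nikodym_integral//=.
by rewrite integral_cst//; exact: alphaE.
Qed.

(* The junk value ln 0 = 0 makes the right-hand side correct at c = 0. *)
Lemma KL_proportional :
  KL alpha beta = ((c * ln c - c + 1)%:E * beta setT)%E.
Proof.
rewrite /KL; case: asboolP => // _.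
have mlne : measurable_fun setT
    (fun y => lne ('d (charge_of_finite_measure alpha) '/d beta y)).
  apply: measurableT_comp; first exact: measurable_lne.
  exact/measurable_int/Radon_Nikodym_integrable.
have betaT : beta setT \is a fin_num by exact: fin_num_measure.
have -> : (\int[alpha]_y lne ('d (charge_of_finite_measure alpha) '/d beta y)
    = (c * ln c)%:E * beta setT)%E.
  (* For [c = 0] the integrand is [-oo] almost everywhere for [beta], but [alpha] is the zero
     measure and the integral vanishes. *)
  move: c_ge0; rewrite le_eqVlt => /orP[/eqP c0|c_gt0].
    have alpha0 : alpha setT = 0%E by rewrite alphaE// -c0 mul0e.
    by rewrite (null_set_integral _ mlne)// -c0 mul0r mul0e.
  rewrite (ae_eq_integral (cst (ln c)%:E) _ _ mlne)//.
    rewrite integral_cst// (_ : (_ * _)%E = (ln c)%:E * (c%:E * beta setT))%E.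
      by rewrite muleA -EFinM mulrC.
    by congr (_ * _)%E; exact: alphaE.
  (* The density is known only up to [beta]-null sets; domination makes these [alpha]-null. *)
  apply: (null_dominates_ae_eq measurableT alpha_dom).
  by rewrite -lne_EFin//; exact: (ae_eq_comp (@lne R) density_cst).
rewrite alphaE// -(fineK betaT) -!EFinM -!EFinD; congr EFin.
ring.
Qed.

End KL_proportional.

(** By convexity: the left-hand side is the tangent at [y] of [x ln x], whose slope there is
    [ln y + 1]. For [x > 0] it amounts to [ln u <= u - 1] at [u = y / x], multiplied by [x]. *)
Lemma tangent_xlnx (R : realType) (x y : R) : 0 <= x -> 0 < y ->
  x * ln y + x - y <= x * ln x.
Proof.
rewrite le_eqVlt => /orP[/eqP <- y0|x0 y0].
  by rewrite !mul0r !add0r oppr_le0 ltW.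
have /(ler_wpM2l (ltW x0)) : ln (y / x) <= y / x - 1.
  rewrite -{1}(subrKC 1 (y / x)) le_ln1Dx//.
  by rewrite ltrBrDr addNr divr_gt0.
rewrite ln_div ?posrE// !mulrBr mulrCA divff ?gt_eqF// !mulr1.
lra.
Qed.

Section objective.
Context d (X : measurableType d) (R : realType).
Variables (dist : X -> X -> R) (r eta1 eta2 lambda : R).
Variables (mu nu : {finite_measure set X -> \bar R}).
Hypothesis dist_meas :
  measurable_fun [set: X * X] (fun z => dist z.1 z.2).

Local Notation M := (fine (mu setT)).
Local Notation N := (fine (nu setT)).
Local Notation T := (transport_cost dist r (finite_product mu nu)).

Lemma transport_cost_mscale (c : {nonneg R}) :
  transport_cost dist r (mscale c (finite_product mu nu)) = (c%:num%:E * T)%E.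
Proof.
apply: ge0_integral_mscale => //; last first.
  by move=> z _; rewrite lee_fin powR_ge0.
apply/measurable_EFinP.
exact: (measurableT_comp (@measurable_powR R r) dist_meas).
Qed.

(** The marginals of [c . mu (x) nu] are [c N . mu] and [c M . nu], so [KL_proportional] evaluates
    all three divergences. Only the transport term can be infinite. *)
Lemma UOT_objective_mscale (c : {nonneg R}) :
  UOT_objective dist r eta1 eta2 lambda mu nu
    (mscale c (finite_product mu nu)) =
  (c%:num%:E * T +
   ((1 / lambda) * ((c%:num * ln c%:num - c%:num + 1) * (M * N)) +
    eta1 * ((c%:num * N * ln (c%:num * N) - c%:num * N + 1) * M) +
    eta2 * ((c%:num * M * ln (c%:num * M) - c%:num * M + 1) * N))%:E)%E.
Proof.
have muT : mu setT = M%:E by rewrite fineK// fin_num_measure.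
have nuT : nu setT = N%:E by rewrite fineK// fin_num_measure.
have M0 : 0 <= M by rewrite fine_ge0.
have N0 : 0 <= N by rewrite fine_ge0.
rewrite /UOT_objective.
rewrite (@KL_proportional _ _ _ _ _ c%:num)//.
rewrite (@KL_proportional _ _ _ _ mu (c%:num * N)) ?mulr_ge0//; last first.
  move=> A mA; rewrite /marginal1 /pushforward /= /mscale/= /finite_product.
  rewrite -setXT product_measure1E// EFinM -nuT -muleA; congr (_ * _)%E.
  exact: muleC.
rewrite (@KL_proportional _ _ _ _ nu (c%:num * M)) ?mulr_ge0//; last first.
  move=> A mA; rewrite /marginal2 /pushforward /= /mscale/= /finite_product.
  by rewrite -setTX product_measure1E// EFinM -muT -muleA.
rewrite transport_cost_mscale; move: (_ * T)%E => t.
have prodT : (finite_product mu nu : {finite_measure set (X * X)%type -> \bar R})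
    setT = (M * N)%:E.
  by rewrite EFinM -muT -nuT -product_measure1E// setXTT.
rewrite prodT muT nuT /= -!EFinM.
by rewrite -!addeA -!EFinD addrA.
Qed.

End objective.

Theorem proposition2p9 (R : realType) (m : nat) (X : set 'rV[R]_m)
    (X0 : X !=set0)
    (dist : borel_subset X0 -> borel_subset X0 -> R)
    (dist_ge0 : forall x y, 0 <= dist x y)
    (dist_meas : measurable_fun [set: borel_subset X0 * borel_subset X0]
                   (fun z => dist z.1 z.2))
    (mu nu : {finite_measure set (borel_subset X0) -> \bar R})
    (mu_radon : radon mu) (nu_radon : radon nu)
    (mu_gt0 : (0 < mu setT)%E) (nu_gt0 : (0 < nu setT)%E)
    (r : R) (r_ge1 : 1 <= r) (lambda : R) (lambda_gt0 : 0 < lambda)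
    (eta1 eta2 : R) (eta1_ge0 : 0 <= eta1) (eta2_ge0 : 0 <= eta2)
    (c : {nonneg R}) :
  (UOT_objective dist r eta1 eta2 lambda mu nu
     (mscale (cstar dist r eta1 eta2 lambda mu nu) (finite_product mu nu))
   <= UOT_objective dist r eta1 eta2 lambda mu nu
        (mscale c (finite_product mu nu)))%E.
Proof.
have [M muT M0] : exists2 M, mu setT = M%:E & 0 < M.
  exists (fine (mu setT)); first by rewrite fineK// fin_num_measure.
  by rewrite fine_gt0// mu_gt0 ltey_eq fin_num_measure.
have [N nuT N0] : exists2 N, nu setT = N%:E & 0 < N.
  exists (fine (nu setT)); first by rewrite fineK// fin_num_measure.
  by rewrite fine_gt0// nu_gt0 ltey_eq fin_num_measure.
have c0 : 0 <= c%:num by [].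
have s0 : 0 < eta1 + eta2 + 1 / lambda.
  by rewrite ltr_wpDl ?addr_ge0// divr_gt0.
rewrite !UOT_objective_mscale// muT nuT /=.
rewrite /cstar_val muT nuT /=.
have : (0 <= transport_cost dist r (finite_product mu nu))%E.
  by apply: integral_ge0 => z _; rewrite lee_fin powR_ge0.
set s := eta1 + eta2 + 1 / lambda in s0 *.
case: (transport_cost _ _ _) => [t||]// t0.
  rewrite -!EFinM inver gt_eqF ?mulr_gt0// -EFinM /=.
  set k := expR _ * _ * _.
  have k0 : 0 < k by rewrite /k !mulr_gt0 ?powR_gt0 ?expR_gt0.
  (* The logarithm of the formula for [c*]; solved for [t], it eliminates the transport cost from
     the objective. *)
  have lnk : M * N * s * ln k =
      - t - M * N * eta1 * ln N - M * N * eta2 * ln M.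
    rewrite /k !lnM ?posrE ?mulr_gt0 ?powR_gt0 ?expR_gt0// !ln_powR expRK.
    by field; rewrite !gt_eqF.
  clearbody k.
  have tE : t = - (M * N * s * ln k) - M * N * eta1 * ln N - M * N * eta2 * ln M.
    by rewrite lnk; ring.
  (* Splits [ln (c N)] and [ln (c M)], including at [c = 0], where [ln] is not additive. *)
  have xlnx (a x : R) : 0 <= a -> 0 < x ->
      a * x * ln (a * x) = a * ln a * x + a * x * ln x.
    rewrite le_eqVlt => /orP[/eqP <- _|a0 x0]; first by rewrite !mul0r addr0.
    by rewrite lnM ?posrE//; ring.
  rewrite -!EFinD lee_fin !xlnx// ?(ltW k0)//.
  (* With [t] eliminated, the [ln M] and [ln N] terms cancel, and the two objectives differ by
     exactly [M N s] times the gap in the tangent inequality. *)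
  have := ler_wpM2l (ltW (mulr_gt0 (mulr_gt0 M0 N0) s0))
    (tangent_xlnx c0 k0).
  rewrite tE /s. lra.
(* Infinite cost: the exponent is [-oo], so [c*] is 0 and [0 * +oo = 0] leaves a finite
   objective. *)
rewrite -!EFinM inver gt_eqF ?mulr_gt0// gt0_mulye ?lte_fin ?invr_gt0 ?mulr_gt0//=.
rewrite !mul0r; move: c0; rewrite le_eqVlt => /orP[/eqP <-|c_gt0].
  by rewrite !mul0r.
by rewrite [X in (_ <= X + _)%E]gt0_muley// addye// leey.
Qed.
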